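(* Let $G$ be a finite group, let $\alpha:\mathbf{B}G\to\mathbf{B}^3U(1)$ be a $U(1)$-valued group 3-cocycle on $G$, and let $\tau_{\mathbf{B}\mathbb{Z}}\alpha:\Lambda G\to\mathbf{B}^2U(1)$ be its transgression to the loop groupoid $\Lambda G$. Let $\rho:\mathbf{B}^2U(1)\to\mathbf{B}\mathrm{Vect}\hookrightarrow 2\mathrm{Vect}$ be the canonical representation. Then the category $\Gamma(\tau_{\mathbf{B}\mathbb{Z}}\alpha)$ of sections of the $\rho$-associated 2-vector bundle $\rho\circ\tau_{\mathbf{B}\mathbb{Z}}\alpha$ is canonically isomorphic to the representation category of the $\alpha$-twisted Drinfeld double of $G$.
   Context: Conventions for cocycles: the composite of $g$ followed by $h$ in $\mathbf{B}G$ is $hg$. A 3-cocycle is a normalized function $\alpha:G^3\to U(1)$ (trivial on degenerate triples) with $\alpha(g,h,k)\alpha(g,kh,l)\alpha(h,k,l)=\alpha(hg,k,l)\alpha(g,h,lk)$ for all $g,h,k,l\in G$. The loop groupoid $\Lambda G=\mathrm{hom}(\mathbf{B}\mathbb{Z},\mathbf{B}G)$ has objects $x\in G$ and morphisms $x\xrightarrow{g}gxg^{-1}$. The transgression is the groupoid 2-cocycle $$(\tau_{\mathbf{B}\mathbb{Z}}\alpha)_x(g,h)=\frac{\alpha(x,g,h)\,\alpha(g,h,(hg)x(hg)^{-1})}{\alpha(g,gxg^{-1},h)}$$ on composable pairs $x\xrightarrow{g}gxg^{-1}\xrightarrow{h}(hg)x(hg)^{-1}$. $\mathrm{Vect}$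 is the category of complex vector spaces (the same choice, e.g. finite-dimensional, being made throughout). $\mathbf{B}\mathrm{Vect}$ is the one-object 2-category with vector spaces as 1-morphisms (composition is $\otimes$) and linear maps as 2-morphisms. The representation $\rho$ sends the single object to the single object, the identity 1-morphism to $\mathbb{C}$, and a 2-morphism $c\in U(1)$ to multiplication by $c$ on $\mathbb{C}$. Sections: the category $\Gamma(\tau_{\mathbf{B}\mathbb{Z}}\alpha)$ has as objects the (pseudonatural) transformations $\sigma:\mathrm{const}_{\mathbb{C}}\Rightarrow\rho\circ\tau_{\mathbf{B}\mathbb{Z}}\alpha$ of 2-functors $\Lambda G\to\mathbf{B}\mathrm{Vect}$, where $\Lambda G$ is resolved so that $\tau_{\mathbf{B}\mathbb{Z}}\alpha$ is a 2-functor. That is, $\sigma$ consists of vector spaces $\sigma(x)$, $x\in G$, and invertible linear maps $\sigma_x(g):\sigma(gxg^{-1})\to\sigma(x)$ for $x,g\in G$, unital for identities, satisfying the naturality condition $$\sigma_x(hg)=(\tau_{\mathbf{B}\mathbb{Z}}\alpha)_x(g,h)\cdot\sigma_x(g)\circ\sigma_{gxg^{-1}}(h).$$ Morphisms are modifications: families of linear maps $\sigma(x)\to\sigma'(x)$ commuting with the $\sigma_x(g)$. The $\alpha$-twisted Drinfeld double of $G$ is, as an algebra, the twisted groupoid algebra of $\Lambda G$ over $\mathbb{C}$. It has basis the morphisms $\langle x\xrightarrow{g}\rangle$ for $x,g\in G$, and product $$\langle gxg^{-1}\xrightarrow{h}\rangle\cdot\langle x\xrightarrow{g}\rangle=(\tau_{\mathbf{B}\mathbb{Z}}\alpha)_x(g,h)\,\langle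 x\xrightarrow{hg}\rangle,$$ all other products of basis elements being $0$. Its representation category is its category of (left) modules.
   Formalization: ''Canonically isomorphic'' is proved as: the canonical direct-sum functor from sections to modules is an equivalence of categories; it is not a strict isomorphism, since a module is only isomorphic, not equal, to the direct sum of its components. *)

(* Defs.v *)
From HB Require Import structures.
From mathcomp Require Import all_boot all_order all_algebra all_fingroup.
From mathcomp Require Import ring complex.
From mathcomp Require Import boolp reals.

Set Implicit Arguments.
Unset Strict Implicit.
Unset Printing Implicit Defensive.

Import GRing.Theory Num.Theory.

Local Open Scope ring_scope.
Local Open Scope complex_scope.

(* Composition is written in the order of functions:
   [compose g f] is "first f, then g". *)
Record category := Category {
  obj :> Type;
  hom : obj -> obj -> Type;
  identity : forall X, hom X X;
  compose : forall X Y Z, hom Y Z -> hom X Y -> hom X Z;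
  compose1m : forall X Y (f : hom X Y), compose (identity Y) f = f;
  composem1 : forall X Y (f : hom X Y), compose f (identity X) = f;
  composeA : forall X Y Z W (h : hom Z W) (g : hom Y Z) (f : hom X Y),
    compose h (compose g f) = compose (compose h g) f }.

Arguments identity {c} X.

Record functor (C D : category) := Functor {
  fobj :> C -> D;
  fmap : forall X Y : C, hom X Y -> hom (fobj X) (fobj Y);
  fmap1 : forall X : C, fmap (identity X) = identity (fobj X);
  fmapM : forall (X Y Z : C) (g : hom Y Z) (f : hom X Y),
    fmap (compose g f) = compose (fmap g) (fmap f) }.

Arguments fmap {C D} F {X Y} f : rename.

Definition functor_id (C : category) : functor C C :=
  @Functor C C id (fun X Y f => f) (fun=> erefl) (fun _ _ _ _ _ => erefl).

Lemma functor_comp_fmap1 (C D E : category) (K : functor D E)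
  (F : functor C D) (X : C) :
  fmap K (fmap F (identity X)) = identity (K (F X)).
Proof. by rewrite !fmap1. Qed.

Lemma functor_comp_fmapM (C D E : category) (K : functor D E)
  (F : functor C D) (X Y Z : C) (g : hom Y Z) (f : hom X Y) :
  fmap K (fmap F (compose g f))
  = compose (fmap K (fmap F g)) (fmap K (fmap F f)).
Proof. by rewrite !fmapM. Qed.

Definition functor_comp (C D E : category) (K : functor D E)
    (F : functor C D) : functor C E :=
  @Functor C E (fun X => K (F X)) (fun X Y f => fmap K (fmap F f))
    (functor_comp_fmap1 K F) (functor_comp_fmapM K F).

Definition is_isomorphism (C : category) (X Y : C) (f : hom X Y) : Prop :=
  exists g : hom Y X, compose g f = identity X /\ compose f g = identity Y.

Definition naturally_isomorphic (C D : category) (F K : functor C D) : Prop :=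
  exists t : forall X : C, hom (F X) (K X),
    (forall X, is_isomorphism (t X)) /\
    (forall (X Y : C) (f : hom X Y),
       compose (t Y) (fmap F f) = compose (fmap K f) (t X)).

Definition is_equivalence (C D : category) (F : functor C D) : Prop :=
  exists K : functor D C,
    naturally_isomorphic (functor_comp K F) (functor_id C) /\
    naturally_isomorphic (functor_comp F K) (functor_id D).

(* The two readings of Vect: all complex vector spaces, or only the
   finite-dimensional ones. *)
Variant vect_choice := all_spaces | finite_dimensional.

Definition is_vect (R : realType) (k : vect_choice) (V : lmodType R[i]) : Prop :=
  match k with
  | all_spaces => True
  | finite_dimensional => exists n, inhabited (Vector.axiom n V)
  end.

(* Normalized 3-cocycles with values in U(1), the unit circle of R[i].  The
   composite in BG of g followed by h is the product h * g. *)
Record cocycle3 (R : realType) (gT : finGroupType) := Cocycle3 {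
  cochain :> gT -> gT -> gT -> R[i];
  cochain_unitary : forall g h k : gT, `|cochain g h k| = 1;
  cochain_norm1 : forall h k : gT, cochain 1%g h k = 1;
  cochain_norm2 : forall g k : gT, cochain g 1%g k = 1;
  cochain_norm3 : forall g h : gT, cochain g h 1%g = 1;
  cochain_cocycle : forall g h k l : gT,
    cochain g h k * cochain g (k * h)%g l * cochain h k l
    = cochain (h * g)%g k l * cochain g h (l * k)%g }.

Section LoopGroupoid.
Variable gT : finGroupType.
Implicit Types x y z w : gT.

Definition loop_target x (g : gT) : gT := (g * x * g^-1)%g.

Definition loop_hom x y : Type := {g : gT | loop_target x g == y}.

Lemma loop_target1 x : loop_target x 1%g == x.
Proof. by rewrite /loop_target mul1g invg1 mulg1. Qed.

Lemma loop_targetM x g h :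
  loop_target x (h * g)%g = loop_target (loop_target x g) h.
Proof. by rewrite /loop_target invMg !mulgA. Qed.

Lemma loop_targetMr x g : (loop_target x g * g)%g = (g * x)%g.
Proof. by rewrite /loop_target -mulgA mulVg mulg1. Qed.

Definition loop_id x : loop_hom x x := exist _ 1%g (loop_target1 x).

Lemma loop_comp_subproof x y z (h : loop_hom y z) (g : loop_hom x y) :
  loop_target x (val h * val g)%g == z.
Proof. by rewrite loop_targetM (eqP (valP g)) (valP h). Qed.

Definition loop_comp x y z (h : loop_hom y z) (g : loop_hom x y) :
  loop_hom x z := exist _ (val h * val g)%g (loop_comp_subproof h g).

Lemma loop_comp1m x y (g : loop_hom x y) : loop_comp (loop_id y) g = g.
Proof. by apply: val_inj; rewrite /= mul1g. Qed.

Lemma loop_compm1 x y (g : loop_hom x y) : loop_comp g (loop_id x) = g.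
Proof. by apply: val_inj; rewrite /= mulg1. Qed.

Lemma loop_compA x y z w (k : loop_hom z w) (h : loop_hom y z)
    (g : loop_hom x y) :
  loop_comp k (loop_comp h g) = loop_comp (loop_comp k h) g.
Proof. by apply: val_inj; rewrite /= mulgA. Qed.

Definition loop_groupoid : category :=
  Category loop_comp1m loop_compm1 loop_compA.

End LoopGroupoid.

Lemma transgression_field (F : fieldType)
    (a1 a2 a3 b1 b2 b3 p1 p2 p3 q1 q2 q3 s t u w : F) :
  p1 * q1 * s = t * b1 -> p3 * u * a1 = t * b3 ->
  p2 * u * a3 = q3 * w -> s * b2 * a2 = q2 * w ->
  a3 != 0 -> b3 != 0 -> p3 != 0 -> q3 != 0 ->
  s != 0 -> t != 0 -> u != 0 -> w != 0 ->
  a1 * a2 / a3 * (b1 * b2 / b3) = p1 * p2 / p3 * (q1 * q2 / q3).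
Proof.
move=> c1 c2 c3 c4 a30 b30 p30 q30 s0 t0 u0 w0.
have e : a1 * a2 * b1 * b2 * p3 * q3 = p1 * p2 * q1 * q2 * a3 * b3.
  apply: (mulIf (mulf_neq0 (mulf_neq0 s0 t0) (mulf_neq0 u0 w0))).
  transitivity ((p3 * u * a1) * (s * b2 * a2) * (t * b1) * (q3 * w)).
    by ring.
  by rewrite c2 c4 -c1 -c3; ring.
rewrite !mulf_div; apply/eqP; rewrite eqr_div ?mulf_neq0 //; apply/eqP.
transitivity (a1 * a2 * b1 * b2 * p3 * q3); first by ring.
by rewrite e; ring.
Qed.

Section Transgression.
Variables (R : realType) (gT : finGroupType) (alpha : cocycle3 R gT).

(* The value at x of the transgressed 2-cocycle on the composable pair
   x --g--> gxg^-1 --h--> (hg)x(hg)^-1. *)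
Definition transgression (x g h : gT) : R[i] :=
  alpha x g h * alpha g h (loop_target x (h * g)%g)
  / alpha g (loop_target x g) h.

Lemma cochain_neq0 g h k : alpha g h k != 0.
Proof. by rewrite -normr_eq0 cochain_unitary oner_neq0. Qed.

Lemma transgression1l x h : transgression x 1%g h = 1.
Proof.
by rewrite /transgression cochain_norm2 !cochain_norm1 divr1 mulr1.
Qed.

Lemma transgression1r x g : transgression x g 1%g = 1.
Proof.
by rewrite /transgression cochain_norm2 !cochain_norm3 divr1 mulr1.
Qed.

Lemma transgression_cocycle x g h k :
  transgression (loop_target x g) h k * transgression x g (k * h)%g
  = transgression x g h * transgression x (h * g)%g k.
Proof.
rewrite /transgression -!loop_targetM !mulgA.
set x1 := loop_target x g; set x2 := loop_target x (h * g)%g.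
set x3 := loop_target x (k * h * g)%g.
have e1 : (x1 * g)%g = (g * x)%g by rewrite /x1 loop_targetMr.
have e2 : (x2 * h)%g = (h * x1)%g.
  by rewrite /x2 loop_targetM loop_targetMr.
have e3 : (x3 * k)%g = (k * x2)%g.
  by rewrite /x3 /x2 -(mulgA k) (loop_targetM _ _ k) loop_targetMr.
have c1 := cochain_cocycle alpha x g h k.
have c2 := cochain_cocycle alpha g x1 h k.
have c3 := cochain_cocycle alpha g h x2 k.
have c4 := cochain_cocycle alpha g h k x3.
rewrite e1 in c2; rewrite e2 in c3; rewrite e3 in c4.
apply: (transgression_field c1 c2 c3 c4); exact: cochain_neq0.
Qed.

End Transgression.

(* The coordinate at (x, g) is the coefficient of the basis element
   <x --g-->>.  The cocycle only selects the product on this type. *)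
Definition twisted_double (R : realType) (gT : finGroupType)
  (alpha : cocycle3 R gT) : Type := {ffun gT * gT -> R[i]}.

Section TwistedDouble.
Variables (R : realType) (gT : finGroupType) (alpha : cocycle3 R gT).
Local Notation twisted_double := (twisted_double alpha).

HB.instance Definition _ :=
  GRing.Lmodule.copy twisted_double {ffun gT * gT -> R[i]^o}.

Definition dd_basis (x g : gT) : twisted_double :=
  [ffun p => (p == (x, g))%:R].

(* The product <y --h-->> . <x --g-->>. *)
Definition dd_basis_mul (y h x g : gT) : twisted_double :=
  if y == loop_target x g
  then transgression alpha x g h *: dd_basis x (h * g)%g else 0.

Definition dd_mul (a b : twisted_double) : twisted_double :=
  \sum_p \sum_q (a p * b q) *: dd_basis_mul p.1 p.2 q.1 q.2.

Definition dd_one : twisted_double := \sum_x dd_basis x 1%g.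

Lemma dd_expand (a : twisted_double) : a = \sum_p a p *: dd_basis p.1 p.2.
Proof.
apply/ffunP => q; rewrite sum_ffunE (bigD1 q) //= !ffunE -surjective_pairing.
rewrite eqxx big1 ?addr0 => [|p pq]; first by rewrite /GRing.scale /= mulr1.
rewrite !ffunE -surjective_pairing eq_sym (negbTE pq).
by rewrite /GRing.scale /= mulr0.
Qed.

Lemma dd_mulDl : left_distributive dd_mul +%R.
Proof.
move=> a b c; rewrite /dd_mul -big_split; apply: eq_bigr => p _.
rewrite -big_split /=; apply: eq_bigr => q _.
by rewrite -scalerDl -mulrDl ffunE.
Qed.

Lemma dd_mulDr : right_distributive dd_mul +%R.
Proof.
move=> a b c; rewrite /dd_mul -big_split; apply: eq_bigr => p _.
rewrite -big_split /=; apply: eq_bigr => q _.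
by rewrite -scalerDl -mulrDr ffunE.
Qed.

Lemma dd_mulZl (c : R[i]) (a b : twisted_double) :
  c *: dd_mul a b = dd_mul (c *: a) b.
Proof.
rewrite /dd_mul scaler_sumr; apply: eq_bigr => p _.
rewrite scaler_sumr; apply: eq_bigr => q _.
by rewrite scalerA mulrA ffunE.
Qed.

Lemma dd_mulZr (c : R[i]) (a b : twisted_double) :
  c *: dd_mul a b = dd_mul a (c *: b).
Proof.
rewrite /dd_mul scaler_sumr; apply: eq_bigr => p _.
rewrite scaler_sumr; apply: eq_bigr => q _.
by rewrite scalerA mulrCA ffunE.
Qed.

Lemma dd_mul0l (a : twisted_double) : dd_mul 0 a = 0.
Proof. by have := dd_mulZl 0 0 a; rewrite !scale0r => <-. Qed.

Lemma dd_mul0r (a : twisted_double) : dd_mul a 0 = 0.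
Proof. by have := dd_mulZr 0 a 0; rewrite !scale0r => <-. Qed.

Lemma dd_mul_suml (I : finType) (F : I -> twisted_double) b :
  dd_mul (\sum_i F i) b = \sum_i dd_mul (F i) b.
Proof. by apply: (big_morph (dd_mul^~ b)) => [c d|]; rewrite ?dd_mulDl ?dd_mul0l. Qed.

Lemma dd_mul_sumr (I : finType) (F : I -> twisted_double) a :
  dd_mul a (\sum_i F i) = \sum_i dd_mul a (F i).
Proof. by apply: (big_morph (dd_mul a)) => [c d|]; rewrite ?dd_mulDr ?dd_mul0r. Qed.

Lemma dd_mul_basis y h x g :
  dd_mul (dd_basis y h) (dd_basis x g) =
  if y == loop_target x g
  then transgression alpha x g h *: dd_basis x (h * g)%g else 0.
Proof.
rewrite /dd_mul (bigD1 (y, h)) //= [X in _ + X]big1 ?addr0 => [|p pn].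
  rewrite (bigD1 (x, g)) //= [X in _ + X]big1 ?addr0 => [|q qn].
    by rewrite !ffunE !eqxx mulr1 scale1r.
  by rewrite !ffunE (negbTE qn) mulr0 scale0r.
by rewrite big1 // => q _; rewrite !ffunE (negbTE pn) mul0r scale0r.
Qed.

Lemma dd_linear_ext (f g : twisted_double -> twisted_double) :
  (forall c a b, f (c *: a + b) = c *: f a + f b) ->
  (forall c a b, g (c *: a + b) = c *: g a + g b) ->
  (forall x h, f (dd_basis x h) = g (dd_basis x h)) -> f =1 g.
Proof.
move=> lf lg fg a.
have f0 : f 0 = 0 by have := lf (-1) 0 0; rewrite scaler0 addr0 scaleN1r addNr.
have g0 : g 0 = 0 by have := lg (-1) 0 0; rewrite scaler0 addr0 scaleN1r addNr.
rewrite (dd_expand a).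
by elim/big_rec: _ => [|p b _ IH]; rewrite ?f0 ?g0 // lf lg fg IH.
Qed.

Lemma dd_mulA : associative dd_mul.
Proof.
move=> a b c; move: a.
apply: (dd_linear_ext (g := fun a => dd_mul (dd_mul a b) c)).
- by move=> d a a'; rewrite dd_mulDl dd_mulZl.
- by move=> d a a'; rewrite !dd_mulDl !dd_mulZl.
move=> z k; move: b.
apply: (dd_linear_ext (f := fun b => dd_mul _ (dd_mul b c))
                      (g := fun b => dd_mul (dd_mul _ b) c)).
- by move=> d b b'; rewrite dd_mulDl dd_mulDr -dd_mulZl -dd_mulZr.
- by move=> d b b'; rewrite dd_mulDr dd_mulDl -dd_mulZr -dd_mulZl.
move=> y h; move: c.
apply: (dd_linear_ext (f := fun c => dd_mul _ (dd_mul _ c))).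
- by move=> d c c'; rewrite !dd_mulDr -!dd_mulZr.
- by move=> d c c'; rewrite dd_mulDr -dd_mulZr.
move=> x g; rewrite !dd_mul_basis.
have [->|ny] := eqVneq y (loop_target x g); last first.
  rewrite dd_mul0r; case: ifP => _; last by rewrite dd_mul0l.
  by rewrite -dd_mulZl dd_mul_basis (negbTE ny) scaler0.
rewrite -dd_mulZr dd_mul_basis -loop_targetM.
case: ifP => _; last by rewrite scaler0 dd_mul0l.
rewrite -dd_mulZl dd_mul_basis eqxx !scalerA mulgA.
by rewrite transgression_cocycle.
Qed.

Lemma dd_mul1l : left_id dd_one dd_mul.
Proof.
move=> a; rewrite {2}(dd_expand a) {1}(dd_expand a) dd_mul_sumr.
apply: eq_bigr => -[x g] _; rewrite -dd_mulZr /=; congr (_ *: _).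
rewrite dd_mul_suml (bigD1 (loop_target x g)) //= dd_mul_basis eqxx.
rewrite transgression1r scale1r mul1g big1 ?addr0 // => y ny.
by rewrite dd_mul_basis (negbTE ny).
Qed.

Lemma dd_mul1r : right_id dd_one dd_mul.
Proof.
move=> a; rewrite {2}(dd_expand a) {1}(dd_expand a) dd_mul_suml.
apply: eq_bigr => -[x g] _; rewrite -dd_mulZl /=; congr (_ *: _).
rewrite dd_mul_sumr (bigD1 x) //= dd_mul_basis.
rewrite (eqP (loop_target1 x)) eqxx transgression1l scale1r mulg1.
rewrite big1 ?addr0 // => y ny.
by rewrite dd_mul_basis (eqP (loop_target1 y)) eq_sym (negbTE ny).
Qed.

Lemma dd_one_neq0 : dd_one != 0.
Proof.
apply/eqP => /ffunP /(_ (1%g, 1%g)).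
rewrite sum_ffunE (bigD1 1%g) //= !ffunE eqxx big1 ?addr0 => [/eqP|x nx].
  by rewrite oner_eq0.
by rewrite ffunE xpair_eqE eq_sym (negbTE nx).
Qed.

HB.instance Definition _ := GRing.Zmodule_isNzRing.Build twisted_double
  dd_mulA dd_mul1l dd_mul1r dd_mulDl dd_mulDr dd_one_neq0.

HB.instance Definition _ :=
  GRing.Lmodule_isLalgebra.Build R[i] twisted_double dd_mulZl.

HB.instance Definition _ :=
  GRing.Lalgebra_isAlgebra.Build R[i] twisted_double dd_mulZr.

End TwistedDouble.

Section RestrictScalars.
Variables (K : nzRingType) (A : lalgType K) (M : lmodType A).

Definition restrict_scalars : Type := M.

HB.instance Definition _ := GRing.Zmodule.on restrict_scalars.

Definition restrict_scale (c : K) (m : restrict_scalars) : restrict_scalars :=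
  (c%:A : A) *: (m : M).

Lemma restrict_scaleA (a b : K) m :
  restrict_scale a (restrict_scale b m) = restrict_scale (a * b) m.
Proof. by rewrite /restrict_scale scalerA mulr_algl scalerA. Qed.

Lemma restrict_scale1 : left_id 1 restrict_scale.
Proof. by move=> m; rewrite /restrict_scale !scale1r. Qed.

Lemma restrict_scaleDr : right_distributive restrict_scale +%R.
Proof. by move=> a m n; rewrite /restrict_scale -scalerDr. Qed.

Lemma restrict_scaleDl m : {morph restrict_scale^~ m : a b / a + b}.
Proof. by move=> a b; rewrite /restrict_scale !scalerDl. Qed.

HB.instance Definition _ := GRing.Zmodule_isLmodule.Build K restrict_scalars
  restrict_scaleA restrict_scale1 restrict_scaleDr restrict_scaleDl.

End RestrictScalars.

Lemma linear_ext (K : pzRingType) (V W : lmodType K) (f g : {linear V -> W}) :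
  f =1 g -> f = g.
Proof.
case: f => f [[f1] [f2]]; case: g => g [[g1] [g2]] /= fg.
have {fg} fg : f = g by apply: funext.
subst g; have -> : f1 = g1 by exact: Prop_irrelevance.
by have -> : f2 = g2 by exact: Prop_irrelevance.
Qed.

Section Representations.
Variables (R : realType) (gT : finGroupType) (alpha : cocycle3 R gT).
Variable k : vect_choice.

Record representation := Representation {
  rep_module :> lmodType (twisted_double alpha);
  rep_vect : is_vect k (restrict_scalars rep_module : lmodType R[i]) }.

Definition rep_hom (M N : representation) : Type := {linear M -> N}.

Definition rep_id (M : representation) : rep_hom M M := idfun.

Definition rep_comp (M N P : representation) (h : rep_hom N P)
  (f : rep_hom M N) : rep_hom M P := h \o f.

Lemma rep_comp1m M N (f : rep_hom M N) : rep_comp (rep_id N) f = f.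
Proof. exact: linear_ext. Qed.

Lemma rep_compm1 M N (f : rep_hom M N) : rep_comp f (rep_id M) = f.
Proof. exact: linear_ext. Qed.

Lemma rep_compA M N P Q (h : rep_hom P Q) (g : rep_hom N P)
    (f : rep_hom M N) :
  rep_comp h (rep_comp g f) = rep_comp (rep_comp h g) f.
Proof. exact: linear_ext. Qed.

Definition Rep : category := Category rep_comp1m rep_compm1 rep_compA.

End Representations.

Section Sections.
Variables (R : realType) (gT : finGroupType) (alpha : cocycle3 R gT).
Variable k : vect_choice.

(* An arrow g : x -> y of the loop groupoid, i.e. an element g of the group
   with y = gxg^-1, is sent to the map sigma_x(g) from sigma(y) to sigma(x). *)
Record twisted_section := TwistedSection {
  fiber :> gT -> lmodType R[i];
  fiber_vect : forall x, is_vect k (fiber x);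
  transport : forall x y : loop_groupoid gT,
    hom x y -> {linear fiber y -> fiber x};
  transport_bij : forall (x y : loop_groupoid gT) (g : hom x y),
    bijective (transport g);
  transport1 : forall (x : loop_groupoid gT) (v : fiber x),
    transport (identity x) v = v;
  transportM : forall (x y z : loop_groupoid gT) (g : hom x y) (h : hom y z)
      (v : fiber z),
    transport (compose h g) v
    = transgression alpha x (val g) (val h) *: transport g (transport h v) }.

Record section_hom (s t : twisted_section) := SectionHom {
  component :> forall x : gT, {linear s x -> t x};
  component_natural : forall (x y : loop_groupoid gT) (g : hom x y) (v : s y),
    component x (transport s g v) = transport t g (component y v) }.

Lemma section_hom_ext s t (f g : section_hom s t) :
  (forall x, f x =1 g x) -> f = g.
Proof.
case: f => f nf; case: g => g ng /= fg.
have {fg} fg : f = g.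
  by apply: functional_extensionality_dep => x; apply: linear_ext => v; apply: fg.
by subst g; rewrite (Prop_irrelevance nf ng).
Qed.

Definition section_id s : section_hom s s :=
  @SectionHom s s (fun x => idfun) (fun _ _ _ _ => erefl).

Lemma section_comp_natural s t u (h : section_hom t u) (f : section_hom s t)
    (x y : loop_groupoid gT) (g : hom x y) (v : s y) :
  h x (f x (transport s g v)) = transport u g (h y (f y v)).
Proof. by rewrite !component_natural. Qed.

Definition section_comp s t u (h : section_hom t u) (f : section_hom s t) :
    section_hom s u :=
  @SectionHom s u (fun x => h x \o f x) (section_comp_natural h f).

Lemma section_comp1m s t (f : section_hom s t) :
  section_comp (section_id t) f = f.
Proof. exact: section_hom_ext. Qed.

Lemma section_compm1 s t (f : section_hom s t) :
  section_comp f (section_id s) = f.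
Proof. exact: section_hom_ext. Qed.

Lemma section_compA s t u w (h : section_hom u w) (g : section_hom t u)
    (f : section_hom s t) :
  section_comp h (section_comp g f) = section_comp (section_comp h g) f.
Proof. exact: section_hom_ext. Qed.

Definition Gamma : category :=
  Category section_comp1m section_compm1 section_compA.

End Sections.

(* F is the canonical comparison functor: the space underlying F(s) is the
   direct sum of the fibers s(x), with injections iota; the basis element
   <x --g-->> acts on the summand s(x) as the inverse of s_x(g), with values
   in the summand s(gxg^-1), and by 0 on the other summands; and F acts on
   morphisms componentwise. *)
Definition is_canonical (R : realType) (gT : finGroupType)
    (alpha : cocycle3 R gT) (k : vect_choice)
    (F : functor (Gamma alpha k) (Rep alpha k)) : Prop :=
  exists iota : forall (s : Gamma alpha k) (x : gT),
      {linear s x -> restrict_scalars (F s)},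
    [/\ forall s : Gamma alpha k,
          bijective (fun v : forall x, s x => \sum_x iota s x (v x)),
        forall (s : Gamma alpha k) (x y : loop_groupoid gT) (g : hom x y) (v : s y),
          (dd_basis alpha x (val g) *: (iota s x (transport s g v) : F s)
            : F s) = iota s y v,
        forall (s : Gamma alpha k) (x g z : gT) (v : s z), z != x ->
          dd_basis alpha x g *: (iota s z v : F s) = 0 :> F s
      & forall (s t : Gamma alpha k) (f : hom s t) (x : gT) (v : s x),
          fmap F f (iota s x v) = iota t x (f x v)].

(* Main.v *)
(* A section s is sent to the direct sum of its fibers, on which <x --g-->> acts
   as the inverse of s_x(g); the naturality condition on s is exactly
   associativity of this action.  The comparison is fully faithful because the
   idempotents <x --1-->> recover the summands, and it is essentially surjective
   because a module M is the direct sum of the images e_x M of these orthogonal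
   idempotents, between which the <x --g-->> act invertibly. *)
From HB Require Import structures.
From mathcomp Require Import all_boot all_order all_algebra all_fingroup.
From mathcomp Require Import complex.
From mathcomp Require Import boolp reals.
Require Import Defs.

Set Implicit Arguments.
Unset Strict Implicit.
Unset Printing Implicit Defensive.

Import GRing.Theory Num.Theory.

Local Open Scope ring_scope.
Local Open Scope complex_scope.

(** * Fully faithful and essentially surjective functors *)

(** Choice supplies preimages of objects and of morphisms. Faithfulness makes the chosen morphisms
    unique, so every law of the quasi-inverse can be checked after applying [F]. *)
Lemma fully_faithful_essentially_surjective_equivalence (C D : category)
    (F : functor C D) :
  (forall (X Y : C) (f g : hom X Y), fmap F f = fmap F g -> f = g) ->
  (forall (X Y : C) (h : hom (F X) (F Y)), exists f, fmap F f = h) ->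
  (forall Y : D, exists (X : C) (h : hom (F X) Y), is_isomorphism h) ->
  is_equivalence F.
Proof.
move=> faithF fullF essF.
pose pre X Y h := sval (cid (fullF X Y h)).
have preK X Y h : fmap F (pre X Y h) = h by exact: svalP (cid (fullF X Y h)).
pose K Y := sval (cid (essF Y)).
pose e Y := sval (cid (svalP (cid (essF Y)))) : hom (F (K Y)) Y.
have e_iso Y : is_isomorphism (e Y).
  exact: svalP (cid (svalP (cid (essF Y)))).
pose e' Y := sval (cid (e_iso Y)) : hom Y (F (K Y)).
have e'K Y : compose (e' Y) (e Y) = identity (F (K Y)).
  by case: (svalP (cid (e_iso Y))).
have eK Y : compose (e Y) (e' Y) = identity Y.
  by case: (svalP (cid (e_iso Y))).
(* Conjugation by the chosen isomorphisms is forced: it is what makes [e] natural. *)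
pose Kmap Y Z (h : hom Y Z) : hom (K Y) (K Z) :=
  pre (K Y) (K Z) (compose (e' Z) (compose h (e Y))).
have K1 Y : Kmap Y Y (identity Y) = identity (K Y).
  by apply: faithF; rewrite preK fmap1 compose1m e'K.
have KM Y Z W (h : hom Z W) (f : hom Y Z) :
    Kmap Y W (compose h f) = compose (Kmap Z W h) (Kmap Y Z f).
  apply: faithF; rewrite fmapM !preK -!composeA; congr compose.
  by congr compose; rewrite (composeA (e Z)) eK compose1m.
exists (Functor K1 KM); split.
  exists (fun X => pre (K (F X)) X (e (F X))); split=> [X|X Y f].
    exists (pre X (K (F X)) (e' (F X))).
    by split; apply: faithF; rewrite fmapM !preK fmap1 ?e'K ?eK.
  apply: faithF; rewrite !fmapM /= !preK composeA eK.
  by rewrite compose1m.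
exists e; split=> [Y|Y Z h] //=.
by rewrite preK composeA eK compose1m.
Qed.

(** * Finite dimension and direct products *)

(** An arbitrary [lmodType] carries no dimension to bound. Among the subspaces of [W] inside the
    image of [f], one of maximal dimension absorbs every line spanned by some [f v], so it is the
    whole image, and [f] identifies [V] with it. *)
Lemma finite_dimensional_embedded (K : fieldType) (V : lmodType K)
    (W : vectType K) (f : {linear V -> W}) :
  injective f -> exists n, inhabited (Vector.axiom n V).
Proof.
move=> f_inj.
pose P n := `[< exists U : {vspace W},
  \dim U = n /\ forall w, w \in U -> exists v, f v = w >].
have P0 : exists n, P n.
  exists 0%N; apply/asboolP; exists 0%VS; split; first by rewrite dimv0.
  by move=> w; rewrite memv0 => /eqP ->; exists 0; rewrite linear0.
have Ple n : P n -> (n <= \dim {:W})%N.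
  by move/asboolP => [U [<- _]]; rewrite dimvS ?subvf.
case: (ex_maxnP P0 Ple) => n /asboolP [U [dimU imU]] maxU.
have fU v : f v \in U.
  have Pfv : P (\dim (U + <[f v]>)%VS).
    apply/asboolP; exists (U + <[f v]>)%VS; split=> // w.
    move=> /memv_addP[u /imU[u' <-] [w' /vlineP[c ->] ->]].
    by exists (u' + c *: v); rewrite linearD linearZ.
  have : (U == U + <[f v]>)%VS by rewrite eqEdim addvSl dimU maxU.
  by move/eqP ->; rewrite (subvP (addvSr _ _)) ?memv_line.
pose fr v : subvs_of U := Subvs (fU v).
have fr_lin : linear fr by move=> c u v; apply: val_inj; rewrite /= linearP.
have fr_bij : bijective fr.
  have surj (w : subvs_of U) : exists v, fr v = w.
    have [v fv] := imU _ (valP w).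
    by exists v; apply: val_inj.
  exists (fun w => sval (cid (surj w))) => [v|w].
    by apply: f_inj; have /(congr1 val) := svalP (cid (surj (fr v))).
  exact: svalP (cid (surj w)).
have [r2 r2_lin r2_bij] := subvs_vect_iso U.
exists (\dim U); constructor; exists (r2 \o fr); last exact: bij_comp.
by move=> c u v; rewrite /= fr_lin r2_lin.
Qed.

Section DirectProduct.
Variables (K : pzRingType) (I : Type) (V : I -> lmodType K).

(** For finite [I] this product is also the direct sum, which is how it is used below. *)
Definition dirprod : Type := forall i, V i.

HB.instance Definition _ := Choice.copy dirprod (forall i, V i).

Implicit Types u v w : dirprod.

Lemma dirprodP u v : (forall i, u i = v i) -> u = v.
Proof. exact: functional_extensionality_dep. Qed.

Let add u v : dirprod := fun i => u i + v i.
Let opp u : dirprod := fun i => - u i.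
Let zero : dirprod := fun=> 0.

Fact dirprod_addA : associative add.
Proof. by move=> u v w; apply: dirprodP => i; exact: addrA. Qed.
Fact dirprod_addC : commutative add.
Proof. by move=> u v; apply: dirprodP => i; exact: addrC. Qed.
Fact dirprod_add0 : left_id zero add.
Proof. by move=> u; apply: dirprodP => i; exact: add0r. Qed.
Fact dirprod_addN : left_inverse zero opp add.
Proof. by move=> u; apply: dirprodP => i; exact: addNr. Qed.

HB.instance Definition _ := GRing.isZmodule.Build dirprod
  dirprod_addA dirprod_addC dirprod_add0 dirprod_addN.

Let scale (c : K) u : dirprod := fun i => c *: u i.

Fact dirprod_scaleA a b u : scale a (scale b u) = scale (a * b) u.
Proof. by apply: dirprodP => i; exact: scalerA. Qed.
Fact dirprod_scale1 : left_id 1 scale.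
Proof. by move=> u; apply: dirprodP => i; exact: scale1r. Qed.
Fact dirprod_scaleDr : right_distributive scale +%R.
Proof. by move=> a u v; apply: dirprodP => i; exact: scalerDr. Qed.
Fact dirprod_scaleDl u : {morph scale^~ u : a b / a + b}.
Proof. by move=> a b; apply: dirprodP => i; exact: scalerDl. Qed.

HB.instance Definition _ := GRing.Zmodule_isLmodule.Build K dirprod
  dirprod_scaleA dirprod_scale1 dirprod_scaleDr dirprod_scaleDl.

Lemma dirprodDE u v i : (u + v) i = u i + v i. Proof. by []. Qed.
Lemma dirprodZE c u i : (c *: u) i = c *: u i. Proof. by []. Qed.

Lemma dirprod_sumE (J : finType) (F : J -> dirprod) i :
  (\sum_j F j) i = \sum_j F j i.
Proof. exact: (big_morph (fun u : dirprod => u i)). Qed.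

End DirectProduct.

Section Injections.
Variables (K : pzRingType) (I : finType) (V : I -> lmodType K).

(** The type [V j] depends on the index, so [v] has to be carried along a proof of [i = j]. *)
Definition dirprod_inj i (v : V i) : dirprod V :=
  fun j => if i =P j is ReflectT e then ecast j (V j) e v else 0.

Lemma dirprod_injE i (v : V i) : dirprod_inj v i = v.
Proof. by rewrite /dirprod_inj; case: eqP => // e; rewrite eq_axiomK. Qed.

Lemma dirprod_inj0 i j (v : V i) : i != j -> dirprod_inj v j = 0.
Proof. by rewrite /dirprod_inj; case: eqP. Qed.

Fact dirprod_inj_linear i : linear (@dirprod_inj i).
Proof.
move=> c u v; apply: dirprodP => j; rewrite dirprodDE dirprodZE.
have [<-|ij] := eqVneq i j; first by rewrite !dirprod_injE.
by rewrite !dirprod_inj0 // scaler0 addr0.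
Qed.

HB.instance Definition _ i := GRing.isLinear.Build K (V i) (dirprod V) _
  (@dirprod_inj i) (@dirprod_inj_linear i).

Lemma dirprod_sum_inj (v : dirprod V) : \sum_i dirprod_inj (v i) = v.
Proof.
apply: dirprodP => j; rewrite dirprod_sumE (bigD1 j) //= dirprod_injE.
by rewrite big1 ?addr0 // => i ij; rewrite dirprod_inj0.
Qed.

End Injections.

(** Coordinates on the factors, concatenated into one long row, embed the product in a space of row
    vectors. *)
Lemma finite_dimensional_dirprod (K : fieldType) (I : finType)
    (V : I -> lmodType K) :
  (forall i, exists n, inhabited (Vector.axiom n (V i))) ->
  exists n, inhabited (Vector.axiom n (dirprod V)).
Proof.
move=> fdV.
have emb i : exists n (r : {linear V i -> 'rV[K]_n}), injective r.
  have [n [[r r_lin r_bij]]] := fdV i.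
  pose rL : {linear V i -> 'rV[K]_n} :=
    HB.pack r (GRing.isLinear.Build K (V i) _ _ r r_lin).
  by exists n, rL; apply: bij_inj r_bij.
pose n i := sval (cid (emb i)).
pose r i : {linear V i -> 'rV[K]_(n i)} := sval (cid (svalP (cid (emb i)))).
have r_inj i : injective (r i) by exact: (svalP (cid (svalP (cid (emb i))))).
(* Blocks of a row are indexed by ordinals, hence the passage through [enum_val]. *)
pose f (v : dirprod V) := \mxrow_(j < #|I|) r _ (v (enum_val j)).
have f_lin : linear f.
  by move=> c u v; apply/rowP => k; rewrite !mxE linearP !mxE.
pose fL : {linear dirprod V -> 'rV[K]_(\sum_(j < #|I|) n (enum_val j))} :=
  HB.pack f (GRing.isLinear.Build K (dirprod V) _ _ f f_lin).
apply: (@finite_dimensional_embedded _ _ _ fL) => u v.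
move=> /(congr1 (fun w => submxrow w)) uv.
apply: dirprodP => i; apply: r_inj; move/(congr1 (@^~ (enum_rank i))): uv.
by rewrite /= !mxrowK enum_rankK.
Qed.

(** * Fixed vectors of an endomorphism *)

Section FixedSpace.
Variables (K : pzRingType) (V : lmodType K) (p : {linear V -> V}).

(** For an idempotent [p] this is its image, given by a boolean equation so that it defines a
    subtype. *)
Definition fixed_vector : {pred V} := [pred v | p v == v].

Fact fixed_vector_submod : submod_closed fixed_vector.
Proof.
split=> [|c u v]; rewrite !inE ?linear0 // => /eqP pu /eqP pv.
by rewrite linearP pu pv.
Qed.

Record fixed_space : Type :=
  FixedSpace { fixed_val : V; fixed_valP : fixed_val \in fixed_vector }.

HB.instance Definition _ := [isSub for fixed_val].
HB.instance Definition _ := [Choice of fixed_space by <:].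
HB.instance Definition _ := GRing.SubChoice_isSubLmodule.Build K V
  fixed_vector fixed_space (GRing.submod_closed_semi fixed_vector_submod).

Lemma fixed_space_eq (v : fixed_space) : p (val v) = val v.
Proof. exact: eqP (valP v). Qed.

End FixedSpace.

(** * The direct sum of the fibers of a section as a module over the double *)

Section Arrows.
Variables (R : realType) (gT : finGroupType) (alpha : cocycle3 R gT).
Implicit Types x y g h : gT.

Definition loop_arrow x g : loop_hom x (loop_target x g) :=
  exist _ g (eqxx (loop_target x g)).

Lemma transgression_neq0 x g h : transgression alpha x g h != 0.
Proof. by rewrite /transgression !mulf_neq0 ?invr_neq0 ?cochain_neq0. Qed.

End Arrows.

Section TotalSpace.
Variables (R : realType) (gT : finGroupType) (alpha : cocycle3 R gT).
Variables (k : vect_choice) (s : twisted_section alpha k).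
Implicit Types (x y z g h : gT).

Lemma untransport_ex x y (g : loop_hom x y) :
  exists f : {linear s x -> s y},
    cancel (transport s g) f /\ cancel f (transport s g).
Proof.
have [f gK fK] := transport_bij s g.
have f_lin : linear f by apply: (can2_linear gK fK).
pose fL : {linear s x -> s y} :=
  HB.pack f (GRing.isLinear.Build R[i] (s x) (s y) _ f f_lin).
by exists fL.
Qed.

Definition untransport x y (g : loop_hom x y) : {linear s x -> s y} :=
  sval (cid (untransport_ex g)).

Lemma transportK x y (g : loop_hom x y) :
  cancel (transport s g) (untransport g).
Proof. by case: (svalP (cid (untransport_ex g))). Qed.

Lemma untransportK x y (g : loop_hom x y) :
  cancel (untransport g) (transport s g).
Proof. by case: (svalP (cid (untransport_ex g))). Qed.

Lemma untransport1 x v : untransport (loop_id x) v = v.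
Proof. by rewrite -{1}(transport1 v) transportK. Qed.

(** Inverting the naturality condition reverses the order of composition and inverts the scalar.
    Moved to the other side, the scalar becomes the structure constant of the product in the
    double. *)
Lemma untransportM x y z (g : loop_hom x y) (h : loop_hom y z) v :
  untransport h (untransport g v) =
  transgression alpha x (val g) (val h) *: untransport (loop_comp h g) v.
Proof.
rewrite -linearZ; set w := untransport h _.
have := transportM (t := s) g h w; rewrite !untransportK => <-.
by rewrite transportK.
Qed.

(** The action of the basis element [<x --g-->>]. *)
Definition section_move x g (v : dirprod s) : dirprod s :=
  dirprod_inj (untransport (loop_arrow x g) (v x)).

Lemma section_move_linear x g : linear (section_move x g).
Proof. by move=> c u v; rewrite /section_move !linearP. Qed.

HB.instance Definition _ x g := GRing.isLinear.Build R[i] (dirprod s)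
  (dirprod s) _ (section_move x g) (section_move_linear x g).

(** Frees the target from the literal form [loop_target x g], so that composites and identities of
    arrows can be used. After elimination of the equality, the two arrows differ only in a boolean
    proof. *)
Lemma section_moveE x y (g : loop_hom x y) v :
  section_move x (val g) v = dirprod_inj (untransport g (v x)).
Proof.
case: g => g xy /=; have e := eqP xy; case: y / e xy => xy.
by rewrite /section_move (_ : loop_arrow x g = exist _ g xy) //; apply: val_inj.
Qed.

Lemma section_move1 v : \sum_x section_move x 1%g v = v.
Proof.
rewrite -[RHS]dirprod_sum_inj; apply: eq_bigr => x _.
by rewrite (section_moveE (loop_id x)) untransport1.
Qed.

(** These are the multiplication rules of the basis elements of the double; associativity of the
    action reduces to them by bilinearity. If [y] is not the target, the component read off at [y]
    is zero. *)
Lemma section_moveM y h x g v :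
  section_move y h (section_move x g v) =
  if y == loop_target x g
  then transgression alpha x g h *: section_move x (h * g)%g v else 0.
Proof.
case: eqVneq => [->|ny]; last first.
  by rewrite /section_move dirprod_inj0 1?eq_sym // !linear0.
rewrite {1 2}/section_move dirprod_injE untransportM linearZ.
congr (_ *: _).
exact: esym (section_moveE (loop_comp (loop_arrow _ h) (loop_arrow x g)) v).
Qed.

Definition section_act (a : twisted_double alpha) (v : dirprod s) : dirprod s :=
  \sum_p a p *: section_move p.1 p.2 v.

Lemma section_act_linear a : linear (section_act a).
Proof.
move=> c u v; rewrite /section_act scaler_sumr -big_split.
by apply: eq_bigr => p _; rewrite linearP scalerDr !scalerA mulrC.
Qed.

HB.instance Definition _ a := GRing.isLinear.Build R[i] (dirprod s)
  (dirprod s) _ (section_act a) (section_act_linear a).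

Lemma section_actDr : right_distributive section_act +%R.
Proof. by move=> a u v; exact: linearD. Qed.

Lemma section_actDl v : {morph section_act^~ v : a b / a + b}.
Proof.
move=> a b; rewrite /section_act -big_split.
by apply: eq_bigr => p _; rewrite ffunE scalerDl.
Qed.

Lemma section_actZl c a v : section_act (c *: a) v = c *: section_act a v.
Proof.
rewrite /section_act scaler_sumr.
by apply: eq_bigr => p _; rewrite ffunE scalerA.
Qed.

Lemma section_act0l v : section_act 0 v = 0.
Proof.
by rewrite -(scale0r (0 : twisted_double alpha)) section_actZl scale0r.
Qed.

Lemma section_act_suml (I : finType) (F : I -> twisted_double alpha) v :
  section_act (\sum_i F i) v = \sum_i section_act (F i) v.
Proof.
apply: (big_morph (section_act^~ v)); last exact: section_act0l.
exact: section_actDl.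
Qed.

Lemma section_act_basis x g v :
  section_act (dd_basis alpha x g) v = section_move x g v.
Proof.
rewrite /section_act (bigD1 (x, g)) //= ffunE eqxx scale1r big1 ?addr0 //.
by move=> p pxg; rewrite ffunE (negbTE pxg) scale0r.
Qed.

Lemma section_act1 : left_id (1 : twisted_double alpha) section_act.
Proof.
(* The unit of the double is the sum of the [<x --1-->>], and each of these projects onto one
   summand. *)
move=> v; rewrite [1]/(dd_one alpha) /dd_one section_act_suml.
rewrite -[RHS]section_move1; apply: eq_bigr => x _.
exact: section_act_basis.
Qed.

Lemma section_actA a b v :
  section_act a (section_act b v) = section_act (a * b) v.
Proof.
rewrite [a * b]/(dd_mul a b) /dd_mul section_act_suml {1}/section_act.
apply: eq_bigr => p _; rewrite section_act_suml {1}/section_act linear_sum.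
rewrite scaler_sumr; apply: eq_bigr => q _.
rewrite linearZ /= scalerA section_actZl section_moveM /dd_basis_mul.
case: ifP => _; last by rewrite section_act0l.
by rewrite section_actZl section_act_basis.
Qed.

(* The alias keeps the action of the double apart from the complex scaling of
   [dirprod s]. *)
Definition total_space : Type := dirprod s.

HB.instance Definition _ := GRing.Zmodule.copy total_space (dirprod s).
HB.instance Definition _ := GRing.Zmodule_isLmodule.Build (twisted_double alpha)
  total_space section_actA section_act1
  section_actDr section_actDl.

End TotalSpace.

(** * The comparison functor and its full faithfulness *)

Lemma is_vect_embedded (R : realType) (k : vect_choice) (V W : lmodType R[i])
    (f : {linear V -> W}) : injective f -> is_vect k W -> is_vect k V.
Proof.
case: k => //= f_inj [n [[r r_lin r_bij]]].
pose rL : {linear W -> 'rV[R[i]]_n} :=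
  HB.pack r (GRing.isLinear.Build R[i] W _ _ r r_lin).
apply: (@finite_dimensional_embedded _ _ _ (rL \o f)).
exact: inj_comp (bij_inj r_bij) f_inj.
Qed.

Lemma is_vect_dirprod (R : realType) (k : vect_choice) (I : finType)
    (V : I -> lmodType R[i]) :
  (forall i, is_vect k (V i)) -> is_vect k (dirprod V).
Proof. by case: k => //=; apply: finite_dimensional_dirprod. Qed.

Section Comparison.
Variables (R : realType) (gT : finGroupType) (alpha : cocycle3 R gT).
Variable k : vect_choice.
Implicit Types (s t : twisted_section alpha k) (x y z g h : gT).

Lemma total_space_scaleE s a (v : dirprod s) :
  a *: (v : total_space s) = section_act a v.
Proof. by []. Qed.

(** Reconciles the two complex structures: restricting scalars along the double gives back the
    fiberwise scaling. *)
Lemma total_space_algE s (c : R[i]) (v : dirprod s) :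
  (c%:A : twisted_double alpha) *: (v : total_space s) = c *: v.
Proof. by rewrite total_space_scaleE section_actZl section_act1. Qed.

(** The identity on vectors, named so that it can carry a proof of linearity between the two
    structures. *)
Definition unrestrict s (v : restrict_scalars (total_space s)) : dirprod s := v.

Fact unrestrict_linear s : linear (@unrestrict s).
Proof.
move=> c u v; rewrite /unrestrict.
by rewrite -[c *: _ in RHS]total_space_algE.
Qed.

HB.instance Definition _ s := GRing.isLinear.Build R[i]
  (restrict_scalars (total_space s)) (dirprod s) _
  (@unrestrict s) (@unrestrict_linear s).

Lemma total_rep_vect s :
  is_vect k (restrict_scalars (total_space s) : lmodType R[i]).
Proof.
apply: (is_vect_embedded (f := @unrestrict s)) => //.
by apply: is_vect_dirprod; apply: fiber_vect.
Qed.

Definition total_rep s : Rep alpha k := Representation (total_rep_vect s).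

Section Map.
Variables (s t : twisted_section alpha k) (f : section_hom s t).

Lemma untransport_natural x y (g : loop_hom x y) (v : s x) :
  f y (untransport s g v) = untransport t g (f x v).
Proof.
by rewrite -{2}(untransportK g v) component_natural transportK.
Qed.

Definition total_map (v : total_space s) : total_space t := fun x => f x (v x).

Lemma total_map_inj x (v : s x) :
  total_map (dirprod_inj v) = dirprod_inj (f x v).
Proof.
apply: dirprodP => y; rewrite /total_map.
have [<-|xy] := eqVneq x y; first by rewrite !dirprod_injE.
by rewrite !dirprod_inj0 // linear0.
Qed.

Lemma total_mapD : {morph total_map : u v / u + v}.
Proof. by move=> u v; apply: dirprodP => x; apply: (linearD (f x)). Qed.

Lemma total_mapZ (c : R[i]) (v : dirprod s) :
  total_map (c *: v) = c *: (total_map v : dirprod t).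
Proof.
by apply: dirprodP => x; rewrite /total_map !dirprodZE linearZ.
Qed.

(** Naturality of [f], passed to the inverse transports, is compatibility with each [section_move];
    the rest is additivity and complex linearity. *)
Lemma total_map_act a v :
  total_map (section_act a v) = section_act a (total_map v).
Proof.
have map0 : total_map 0 = 0.
  by apply: dirprodP => x; rewrite /total_map linear0.
rewrite /section_act (big_morph total_map total_mapD map0).
apply: eq_bigr => p _; rewrite total_mapZ /section_move total_map_inj.
by rewrite untransport_natural.
Qed.

Fact total_map_linear : linear total_map.
Proof.
by move=> a u v; rewrite total_mapD total_space_scaleE total_map_act.
Qed.

HB.instance Definition _ := GRing.isLinear.Build (twisted_double alpha)
  (total_space s) (total_space t) _ total_map total_map_linear.

End Map.

Definition comparison_map s t (f : section_hom s t) :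
  rep_hom (total_rep s) (total_rep t) := total_map f.

(** Transparent, because later definitions need [comparison s] to reduce to [total_rep s]. *)
Definition comparison : functor (Gamma alpha k) (Rep alpha k).
Proof.
by apply: (@Functor (Gamma alpha k) (Rep alpha k) total_rep comparison_map);
  move=> *; apply: linear_ext.
Defined.

Definition total_inj s x (v : s x) : restrict_scalars (comparison s) :=
  dirprod_inj v.

Fact total_inj_linear s x : linear (@total_inj s x).
Proof.
move=> c u v; rewrite /total_inj linearP /=.
by rewrite -[c *: _ in LHS]total_space_algE.
Qed.

HB.instance Definition _ s x := GRing.isLinear.Build R[i] (s x)
  (restrict_scalars (comparison s)) _ (@total_inj s x) (@total_inj_linear s x).

Lemma comparison_canonical : is_canonical comparison.
Proof.
exists (fun s x => @total_inj s x); split.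
- move=> s; exists id => v; exact: dirprod_sum_inj.
- move=> s x y g v; rewrite total_space_scaleE section_act_basis section_moveE.
  by rewrite /= /total_inj dirprod_injE transportK.
- move=> s x g z v zx; rewrite total_space_scaleE section_act_basis.
  by rewrite /section_move /= /total_inj dirprod_inj0 // !linear0.
- by move=> s t f x v; apply: total_map_inj.
Qed.

Lemma comparison_faithful s t (f f' : section_hom s t) :
  comparison_map f = comparison_map f' -> f = f'.
Proof.
move=> ff'; apply: section_hom_ext => x v.
have : comparison_map f (dirprod_inj v) = comparison_map f' (dirprod_inj v).
  by rewrite ff'.
rewrite /= !total_map_inj => /(congr1 (fun u : dirprod t => u x)).
by rewrite !dirprod_injE.
Qed.

(** A map over the double commutes with the idempotents [<x --1-->>], so it is block diagonal. Its
    diagonal blocks are the components, and commuting with [<x --g-->>] makes them natural. *)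
Lemma comparison_full s t (h : rep_hom (total_rep s) (total_rep t)) :
  exists f : section_hom s t, comparison_map f = h.
Proof.
have hZ c (v : dirprod s) : h (c *: v) = c *: (h v : dirprod t).
  by rewrite -total_space_algE linearZ /= total_space_algE.
have h_move x g v : h (section_move x g v) = section_move x g (h v).
  rewrite -section_act_basis -total_space_scaleE linearZ /=.
  by rewrite total_space_scaleE section_act_basis.
pose c x (v : s x) : t x := (h (dirprod_inj v) : dirprod t) x.
have c_lin x : linear (@c x).
  move=> a u v; rewrite /c linearP /= linearD hZ.
  by [].
pose cL x : {linear s x -> t x} :=
  HB.pack (@c x) (GRing.isLinear.Build R[i] (s x) (t x) _ (@c x) (@c_lin x)).
have c_nat (x y : loop_groupoid gT) (g : hom x y) (v : s y) :
    cL x (transport s g v) = transport t g (cL y v).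
  (* After applying the inverse of [transport t g], both sides are components at [y] of [h] on the
     vector supported at [y]. *)
  apply: (can_inj (untransportK g)); rewrite transportK /= /c.
  have := section_moveE g (h (dirprod_inj (transport s g v))).
  rewrite -h_move section_moveE dirprod_injE transportK.
  by move/(congr1 (fun u : dirprod t => u y)) => ->; rewrite dirprod_injE.
exists (SectionHom c_nat); apply: linear_ext => v.
rewrite -[v](dirprod_sum_inj (v : dirprod s)) !linear_sum.
apply: eq_bigr => x _; rewrite /= total_map_inj /= /c.
(* The vector supported at [x] is fixed by [<x --1-->>], hence so is its image under [h], which is
   therefore supported at [x] too. *)
have := section_moveE (loop_id x) (dirprod_inj (v x)).
rewrite dirprod_injE untransport1 => {2}<-.
by rewrite h_move (section_moveE (loop_id x)) untransport1.
Qed.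

End Comparison.

(** * Modules over an algebra as spaces over its scalars *)

Section Underlying.
Variables (K : comNzRingType) (A : algType K) (M : lmodType A).
Local Notation V := (restrict_scalars M).

Lemma restrict_scalars_scaleE c (m : M) : c *: (m : V) = (c%:A : A) *: m.
Proof. by []. Qed.

Definition scalar_op (a : A) (m : V) : V := a *: (m : M).

(** Scalars are central in an algebra, so the action of [a] commutes with them. *)
Fact scalar_op_linear a : linear (scalar_op a).
Proof.
move=> c u v; rewrite /scalar_op scalerDr !restrict_scalars_scaleE !scalerA.
by rewrite mulr_algl mulr_algr.
Qed.

HB.instance Definition _ a := GRing.isLinear.Build K V V _
  (scalar_op a) (scalar_op_linear a).

Lemma scalar_op1 m : scalar_op 1 m = m.
Proof. by rewrite /scalar_op scale1r. Qed.

Lemma scalar_opM a b m : scalar_op a (scalar_op b m) = scalar_op (a * b) m.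
Proof. by rewrite /scalar_op scalerA. Qed.

Lemma scalar_opZ c a m : scalar_op (c *: a) m = c *: scalar_op a m.
Proof. by rewrite restrict_scalars_scaleE /scalar_op scalerA mulr_algl. Qed.

Lemma scalar_op0 m : scalar_op 0 m = 0.
Proof. by rewrite /scalar_op scale0r. Qed.

Lemma scalar_op_sum (I : finType) (F : I -> A) m :
  scalar_op (\sum_i F i) m = \sum_i scalar_op (F i) m.
Proof. by rewrite /scalar_op scaler_suml. Qed.

End Underlying.

(** * Basis elements of the double and inverse arrows *)

Section DoubleBasis.
Variables (R : realType) (gT : finGroupType) (alpha : cocycle3 R gT).
Implicit Types x y z g h : gT.

Lemma dd_basis_comp x y z (g : loop_hom x y) (h : loop_hom y z) :
  dd_basis alpha y (val h) * dd_basis alpha x (val g) =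
  transgression alpha x (val g) (val h)
    *: dd_basis alpha x (val (loop_comp h g)).
Proof. by rewrite [LHS]dd_mul_basis eq_sym (valP g). Qed.

Lemma dd_basis_disjoint y h x g : y != loop_target x g ->
  dd_basis alpha y h * dd_basis alpha x g = 0.
Proof. by move=> ny; rewrite [LHS]dd_mul_basis (negbTE ny). Qed.

Lemma loop_inv_subproof x y (g : loop_hom x y) :
  loop_target y (val g)^-1%g == x.
Proof.
case: g => g /= /eqP <-; rewrite -loop_targetM mulVg.
exact: loop_target1.
Qed.

Definition loop_inv x y (g : loop_hom x y) : loop_hom y x :=
  exist _ (val g)^-1%g (loop_inv_subproof g).

Lemma loop_mulVg x y (g : loop_hom x y) : loop_comp (loop_inv g) g = loop_id x.
Proof. by apply: val_inj; rewrite /= mulVg. Qed.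

Lemma loop_mulgV x y (g : loop_hom x y) : loop_comp g (loop_inv g) = loop_id y.
Proof. by apply: val_inj; rewrite /= mulgV. Qed.

(** The cocycle condition on [g], [g^-1], [g], with two factors trivial by normalization. It makes a
    single scalar serve for both the left and the right inverse of [rep_move g]. *)
Lemma transgression_inv x y (g : loop_hom x y) :
  transgression alpha y (val g)^-1%g (val g) =
  transgression alpha x (val g) (val g)^-1%g.
Proof.
have := transgression_cocycle alpha x (val g) (val g)^-1%g (val g).
by rewrite (eqP (valP g)) mulgV mulVg transgression1r transgression1l !mulr1.
Qed.

End DoubleBasis.

(** * The section defined by a module *)

Section SectionOf.
Variables (R : realType) (gT : finGroupType) (alpha : cocycle3 R gT).
Variables (k : vect_choice) (M : representation alpha k).
Implicit Types x y z g h : gT.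

Local Notation V := (restrict_scalars M).
Local Notation op x g := (@scalar_op _ _ M (dd_basis alpha x g)).

Lemma op_comp x y z (g : loop_hom x y) (h : loop_hom y z) m :
  op y (val h) (op x (val g) m) =
  transgression alpha x (val g) (val h) *: op x (val (loop_comp h g)) m.
Proof. by rewrite scalar_opM dd_basis_comp scalar_opZ. Qed.

Lemma op_idl x y (g : loop_hom x y) m :
  op y 1%g (op x (val g) m) = op x (val g) m.
Proof.
by rewrite (op_comp g (loop_id y)) transgression1r scale1r loop_comp1m.
Qed.

(** The image of the idempotent [<x --1-->>] on the module. *)
Definition rep_fiber x : lmodType R[i] := fixed_space (op x 1%g).

Lemma rep_fiber_vect x : is_vect k (rep_fiber x).
Proof.
apply: (is_vect_embedded (f := val : {linear rep_fiber x -> V})).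
  exact: val_inj.
exact: rep_vect.
Qed.

Lemma rep_move_subproof x y (g : loop_hom x y) m :
  op x (val g) m \in fixed_vector (op y 1%g).
Proof. by apply/eqP; exact: op_idl. Qed.

Definition rep_move x y (g : loop_hom x y) (v : rep_fiber x) : rep_fiber y :=
  FixedSpace (rep_move_subproof g (val v)).

Fact rep_move_linear x y (g : loop_hom x y) : linear (rep_move g).
Proof. by move=> c u v; apply: val_inj; rewrite /= !linearP. Qed.

(* The scalar comes from <y --g^-1-->> . <x --g-->> = tau_x(g, g^-1) <x --1-->>. *)
Definition rep_transport_fun x y (g : loop_hom x y) (v : rep_fiber y) :
    rep_fiber x :=
  (transgression alpha x (val g) (val g)^-1%g)^-1 *: rep_move (loop_inv g) v.

Fact rep_transport_linear x y (g : loop_hom x y) : linear (rep_transport_fun g).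
Proof.
move=> c u v; rewrite /rep_transport_fun rep_move_linear.
by rewrite scalerDr !scalerA mulrC.
Qed.

HB.instance Definition _ x y (g : loop_hom x y) :=
  GRing.isLinear.Build R[i] (rep_fiber x) (rep_fiber y) _
  (rep_move g) (rep_move_linear g).

HB.instance Definition _ x y (g : loop_hom x y) :=
  GRing.isLinear.Build R[i] (rep_fiber y) (rep_fiber x) _
  (rep_transport_fun g) (rep_transport_linear g).

Lemma rep_moveM x y z (g : loop_hom x y) (h : loop_hom y z) v :
  rep_move h (rep_move g v) =
  transgression alpha x (val g) (val h) *: rep_move (loop_comp h g) v.
Proof. by apply: val_inj; rewrite /= op_comp. Qed.

Lemma rep_move1 x v : rep_move (loop_id x) v = v.
Proof. by apply: val_inj; exact: fixed_space_eq. Qed.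

Lemma rep_moveK x y (g : loop_hom x y) :
  cancel (rep_move g) (rep_transport_fun g).
Proof.
move=> v; rewrite /rep_transport_fun rep_moveM loop_mulVg rep_move1 scalerA.
by rewrite mulVf ?scale1r // transgression_neq0.
Qed.

Lemma rep_transportK x y (g : loop_hom x y) :
  cancel (rep_transport_fun g) (rep_move g).
Proof.
move=> v; rewrite linearZ /= rep_moveM loop_mulgV rep_move1 scalerA.
by rewrite transgression_inv mulVf ?scale1r // transgression_neq0.
Qed.

Definition rep_transport (x y : loop_groupoid gT) (g : hom x y) :
  {linear rep_fiber y -> rep_fiber x} := rep_transport_fun g.

Fact rep_transport_bij (x y : loop_groupoid gT) (g : hom x y) :
  bijective (rep_transport g).
Proof. by exists (rep_move g); [exact: rep_transportK | exact: rep_moveK]. Qed.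

Fact rep_transport1 (x : loop_groupoid gT) (v : rep_fiber x) :
  rep_transport (identity x) v = v.
Proof. by rewrite -{1}(rep_move1 v) /= rep_moveK. Qed.

(** The converse passage to [untransportM]: the product rule of the double, inverted, gives the
    naturality condition. *)
Fact rep_transportM (x y z : loop_groupoid gT) (g : hom x y) (h : hom y z)
    (v : rep_fiber z) :
  rep_transport (compose h g) v =
  transgression alpha x (val g) (val h)
    *: rep_transport g (rep_transport h v).
Proof.
apply: (can_inj (rep_moveK (compose h g))); rewrite /= rep_transportK.
by rewrite linearZ /= -rep_moveM !rep_transportK.
Qed.

Definition section_of : twisted_section alpha k :=
  TwistedSection rep_fiber_vect rep_transport_bij rep_transport1 rep_transportM.

(** The map [untransport] comes from choice and does not compute; it is pinned down as the inverse
    of the transport. *)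
Lemma untransport_section_of x y (g : loop_hom x y) v :
  untransport section_of g v = rep_move g v.
Proof.
apply: (can_inj (rep_transportK g)); rewrite rep_moveK.
exact: (untransportK (s := section_of) g).
Qed.

Definition section_eval (v : dirprod section_of) : V := \sum_x val (v x).

Fact section_eval_linear : linear section_eval.
Proof.
move=> c u v; rewrite /section_eval scaler_sumr -big_split.
by apply: eq_bigr => x _; rewrite dirprodDE dirprodZE linearP.
Qed.

HB.instance Definition _ := GRing.isLinear.Build R[i] (dirprod section_of) V _
  section_eval section_eval_linear.

Lemma section_eval_inj x (v : section_of x) :
  section_eval (dirprod_inj v) = val v.
Proof.
rewrite /section_eval (bigD1 x) //= dirprod_injE big1 ?addr0 // => y yx.
by rewrite dirprod_inj0 // eq_sym.
Qed.

(** Orthogonality of the idempotents: [<x --g-->>] kills every summand other than the one at [x]. *)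
Lemma op_section_eval x g (v : dirprod section_of) :
  op x g (section_eval v) = op x g (val (v x)).
Proof.
rewrite /section_eval linear_sum (bigD1 x) //= big1 ?addr0 // => y yx.
(* Writing [v y] as [<y --1-->>] applied to itself exposes a product of non-composable basis
   elements. *)
rewrite -(fixed_space_eq (v y)) scalar_opM dd_basis_disjoint ?scalar_op0 //.
by rewrite (eqP (loop_target1 y)) eq_sym.
Qed.

Lemma section_eval_move x g v :
  section_eval (section_move x g v) = op x g (section_eval v).
Proof.
by rewrite section_eval_inj untransport_section_of op_section_eval.
Qed.

Lemma section_eval_act a v :
  section_eval (section_act a v) = scalar_op a (section_eval v).
Proof.
rewrite {2}(dd_expand a) scalar_op_sum /section_act linear_sum.
apply: eq_bigr => p _; rewrite linearZ scalar_opZ; congr (_ *: _).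
exact: section_eval_move.
Qed.

(** Splits [m] into its components under the idempotents [<x --1-->>]. *)
Definition section_coeval (m : V) : dirprod section_of :=
  fun x => FixedSpace (rep_move_subproof (loop_id x) m).

Lemma section_evalK : cancel section_eval section_coeval.
Proof.
move=> v; apply: dirprodP => x; apply: val_inj => /=.
by rewrite op_section_eval; exact: fixed_space_eq.
Qed.

Lemma section_coevalK : cancel section_coeval section_eval.
Proof.
move=> m; rewrite /section_eval /= -scalar_op_sum.
(* The sum of the idempotents is the unit of the double by definition. *)
exact: scalar_op1.
Qed.

End SectionOf.

(** * Essential surjectivity and the equivalence *)

Lemma rep_bij_isomorphism (R : realType) (gT : finGroupType)
    (alpha : cocycle3 R gT) (k : vect_choice) (M N : Rep alpha k)
    (f : rep_hom M N) : bijective f -> is_isomorphism (f : hom M N).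
Proof.
move=> [f' fK f'K].
have f'_lin : linear f' by apply: (can2_linear fK f'K).
pose f'L : {linear N -> M} :=
  HB.pack f' (GRing.isLinear.Build (twisted_double alpha) N M _ f' f'_lin).
by exists (f'L : rep_hom N M); split; apply: linear_ext; [exact: fK|exact: f'K].
Qed.

(** Summation over the fibers of [section_of M] is bijective and commutes with the whole action of
    the double, so it is an isomorphism onto [M]. *)
Lemma comparison_essentially_surjective (R : realType) (gT : finGroupType)
    (alpha : cocycle3 R gT) (k : vect_choice) (M : Rep alpha k) :
  exists (s : Gamma alpha k) (f : hom (comparison alpha k s) M),
    is_isomorphism f.
Proof.
pose ev : total_space (section_of M) -> M := @section_eval _ _ _ _ M.
have ev_lin : linear ev.
  by move=> a u v; rewrite /ev linearD /= total_space_scaleE section_eval_act.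
pose f : {linear total_space (section_of M) -> M} := HB.pack ev
  (GRing.isLinear.Build (twisted_double alpha) _ _ _ ev ev_lin).
exists (section_of M), f; apply: rep_bij_isomorphism.
exists (@section_coeval _ _ _ _ M); first exact: section_evalK.
exact: section_coevalK.
Qed.

Theorem corollary9p2 (R : realType) (gT : finGroupType)
    (alpha : cocycle3 R gT) (k : vect_choice) :
  exists F : functor (Gamma alpha k) (Rep alpha k),
    is_canonical F /\ is_equivalence F.
Proof.
exists (comparison alpha k); split; first exact: comparison_canonical.
apply: fully_faithful_essentially_surjective_equivalence.
- exact: comparison_faithful.
- exact: comparison_full.
- exact: comparison_essentially_surjective.
Qed.
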